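(* Let $K$ and $L$ be origin-symmetric star bodies in $\mathbb{R}^n$, and let $1\le k<n$ be an integer. Suppose that $K$ is a generalized $k$-intersection body and $\varepsilon>0$. If for every $(n-k)$-dimensional linear subspace $H$ of $\mathbb{R}^n$ $$\mathrm{Vol}_{n-k}(K\cap H)\le \mathrm{Vol}_{n-k}(L\cap H)+\varepsilon,$$ then $$\mathrm{Vol}_n(K)^{\frac{n-k}{n}}\le \mathrm{Vol}_n(L)^{\frac{n-k}{n}}+c_{n,k}\,\varepsilon,$$ where $c_{n,k}=|B_2^n|^{(n-k)/n}/|B_2^{n-k}|$.
   Context: $|B_2^m|$ denotes the volume of the Euclidean unit ball in $\mathbb{R}^m$. $\mathrm{Vol}_m$ is $m$-dimensional Lebesgue measure (on $m$-dimensional linear subspaces, with the induced Euclidean structure). $S^{n-1}$ is the Euclidean unit sphere in $\mathbb{R}^n$. A closed bounded set $K\subset\mathbb{R}^n$ is a star body if every straight line through the origin crosses the boundary of $K$ at exactly two points different from the origin, the origin is an interior point of $K$, and the Minkowski functional $\|x\|_K=\min\{a\ge 0: x\in aK\}$ is a continuous function on $\mathbb{R}^n$. It is origin-symmetric if $K=-K$. $G(n,n-k)$ is the Grassmannian of $(n-k)$-dimensional linear subspaces of $\mathbb{R}^n$. The $(n-k)$-dimensional spherical Radon transform $\mathcal{R}_{n-k}:C(S^{n-1})\to C(G(n,n-k))$ is defined by $\mathcal{R}_{n-k}(f)(H)=\int_{S^{n-1}\cap H} f(x)\,dx$, where integration is with respect to the (unnormalized) surface measure on the unit sphere $S^{n-1}\cap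 H$ of $H$ (counting measure if $n-k=1$). Let $X=\mathcal{R}_{n-k}(C(S^{n-1}))\subset C(G(n,n-k))$, and let $M^+(X)$ be the set of linear continuous (in the sup norm) functionals $\nu$ on $X$ that are positive, i.e. $\nu(g)\ge 0$ for every non-negative $g\in X$. An origin-symmetric star body $K$ in $\mathbb{R}^n$ is a generalized $k$-intersection body if there exists $\nu\in M^+(X)$ such that for every $f\in C(S^{n-1})$, $$\int_{S^{n-1}}\|x\|_K^{-k}f(x)\,dx=\nu(\mathcal{R}_{n-k}(f)),$$ where $dx$ is the unnormalized surface measure on $S^{n-1}$. *)

(* Defs.v *)
(* Vectors of R^n are row vectors 'rV[R]_n, with the topology of the library. *)
From HB Require Import structures.
From mathcomp Require Import all_boot all_order all_algebra.
From mathcomp Require Import all_classical all_reals all_analysis.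
From mathcomp Require Import measurable_realfun.

Set Implicit Arguments.
Unset Strict Implicit.
Unset Printing Implicit Defensive.

Import Order.TTheory GRing.Theory Num.Theory.
Import numFieldNormedType.Exports.

Local Open Scope classical_set_scope.
Local Open Scope ring_scope.

Definition rV_coord (R : realType) (n : nat) (i : 'I_n) (x : 'rV[R]_n) :
  measurableTypeR R := x ord0 i.

Definition rV_display : Type -> measure_display.
Proof. exact. Qed.

(* The Borel sigma-algebra of R^n, presented as the sigma-algebra generated by
   the coordinates (as the library does for tuples). *)
Section measurable_rV.
Variables (R : realType) (n : nat).

Let rV_set0 : g_sigma_preimage (@rV_coord R n) set0.
Proof. exact: sigma_algebra0. Qed.

Let rV_setC A : g_sigma_preimage (@rV_coord R n) A ->
  g_sigma_preimage (@rV_coord R n) (~` A).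
Proof. exact: sigma_algebraC. Qed.

Let rV_bigcup (F : (set 'rV[R]_n)^nat) :
  (forall i, g_sigma_preimage (@rV_coord R n) (F i)) ->
  g_sigma_preimage (@rV_coord R n) (\bigcup_i F i).
Proof. exact: sigma_algebra_bigcup. Qed.

HB.instance Definition _ := @isMeasurable.Build (rV_display R)
  'rV[R]_n (g_sigma_preimage (@rV_coord R n)) rV_set0 rV_setC rV_bigcup.

End measurable_rV.

Lemma measurable_rV_coord (R : realType) n (i : 'I_n) :
  measurable_fun [set: 'rV[R]_n] (rV_coord i).
Proof.
move=> _ Y mY; rewrite setTI; apply: sub_sigma_algebra => /=.
rewrite -bigcup_seq/=; exists i => /=; first by rewrite mem_index_enum.
by exists Y => //; rewrite setTI.
Qed.

Lemma measurable_fun_rVP d (T : measurableType d) (R : realType) n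
    (f : T -> 'rV[R]_n) :
  (forall i, measurable_fun [set: T] (@rV_coord R n i \o f)) ->
  measurable_fun [set: T] f.
Proof.
move=> mf.
suff : g_sigma_preimage (@rV_coord R n) `<=` [set A | measurable (f @^-1` A)].
  by move=> H _ A mA; rewrite setTI; exact: H.
apply: smallest_sub.
  split => /=; first by rewrite preimage_set0.
    by move=> A mA; rewrite setTD preimage_setC; exact: measurableC.
  by move=> F mF; rewrite preimage_bigcup; exact: bigcupT_measurable.
rewrite -bigcup_seq; apply: bigcup_sub => i _ _ [B mB <-] /=.
by rewrite setTI -comp_preimage -[X in measurable X]setTI; exact: mf.
Qed.

(* Lebesgue measure on R^n, as an iterated product of the one on R. *)

Definition rV_cons (R : realType) n (p : measurableTypeR R * 'rV[R]_n) :
    'rV[R]_n.+1 :=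
  \row_i (if unlift ord0 i is Some j then p.2 ord0 j else p.1).

Lemma measurable_rV_cons (R : realType) n :
  measurable_fun [set: measurableTypeR R * 'rV[R]_n] (@rV_cons R n).
Proof.
apply: measurable_fun_rVP => i.
case: (unliftP ord0 i) => [j|] ->.
  rewrite [X in measurable_fun _ X](_ : _ = rV_coord j \o snd).
    by apply: measurableT_comp => //; exact: measurable_rV_coord.
  by apply/funext => p; rewrite /rV_coord /= mxE liftK.
rewrite [X in measurable_fun _ X](_ : _ = fst) //.
by apply/funext => p; rewrite /rV_coord /= mxE unlift_none.
Qed.

HB.instance Definition _ (R : realType) n :=
  @isMeasurableFun.Build _ _ _ _ (@rV_cons R n) (@measurable_rV_cons R n).

Section lebesgue_rV_step.
Variables (R : realType) (n : nat).
Variable mu : {sigma_finite_measure set 'rV[R]_n -> \bar R}.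

Definition lebesgue_rV_step : set 'rV[R]_n.+1 -> \bar R :=
  pushforward (@lebesgue_measure R \x mu)%E (@rV_cons R n).

Let lebesgue_rV_step0 : lebesgue_rV_step set0 = 0%E.
Proof. exact: measure0. Qed.

Let lebesgue_rV_step_ge0 A : (0 <= lebesgue_rV_step A)%E.
Proof. exact: measure_ge0. Qed.

Let lebesgue_rV_step_sigma_additive : semi_sigma_additive lebesgue_rV_step.
Proof. exact: measure_semi_sigma_additive. Qed.

HB.instance Definition _ := isMeasure.Build _ _ _ lebesgue_rV_step
  lebesgue_rV_step0 lebesgue_rV_step_ge0 lebesgue_rV_step_sigma_additive.

Let lebesgue_rV_step_sigma_finite : sigma_finite setT lebesgue_rV_step.
Proof.
have /sigma_finiteP[F [FT Fnd Ffin]] :=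
  @sigma_finiteT _ _ R (@lebesgue_measure R).
have /sigma_finiteP[G [GT Gnd Gfin]] := @sigma_finiteT _ _ R mu.
pose h (x : 'rV[R]_n.+1) : measurableTypeR R * 'rV[R]_n :=
  (x ord0 ord0, \row_j x ord0 (lift ord0 j)).
have hK : cancel (@rV_cons R n) h.
  move=> [x y]; congr pair; first by rewrite mxE unlift_none.
  by apply/rowP => j; rewrite !mxE liftK.
have mh : measurable_fun setT h.
  apply/measurable_fun_pairP; split.
    exact: (@measurable_rV_coord R n.+1 ord0).
  apply: measurable_fun_rVP => j.
  rewrite [X in measurable_fun _ X](_ : _ = rV_coord (lift ord0 j)).
    exact: measurable_rV_coord.
  by apply/funext => x; rewrite /rV_coord /= mxE.
exists (fun i => h @^-1` (F i `*` G i)).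
  apply/esym; rewrite -subTset => x _.
  have : [set: measurableTypeR R] (h x).1 by [].
  rewrite FT => -[i _ Fi].
  have : [set: 'rV[R]_n] (h x).2 by [].
  rewrite GT => -[j _ Gj].
  exists (maxn i j) => //; split.
    by move/subsetPset: (Fnd _ _ (leq_maxl i j)); exact.
  by move/subsetPset: (Gnd _ _ (leq_maxr i j)); exact.
move=> i; have [mF Foo] := Ffin i; have [mG Goo] := Gfin i; split.
  by rewrite -[X in measurable X]setTI; apply: mh => //; exact: measurableX.
rewrite /lebesgue_rV_step /pushforward.
have -> : rV_cons (n:=n) @^-1` (h @^-1` (F i `*` G i)) = F i `*` G i.
  rewrite -comp_preimage (_ : h \o _ = id) ?preimage_id//.
  by apply/funext => p; exact: hK.
by rewrite product_measure1E// lte_mul_pinfty// ge0_fin_numE.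
Qed.

HB.instance Definition _ := Measure_isSigmaFinite.Build _ _ _
  lebesgue_rV_step lebesgue_rV_step_sigma_finite.

End lebesgue_rV_step.

Fixpoint lebesgue_rV (R : realType) (n : nat) :
    {sigma_finite_measure set 'rV[R]_n -> \bar R} :=
  if n is m.+1 then lebesgue_rV_step (lebesgue_rV R m)
  else \d_(0 : 'rV[R]_0).

Section euclidean.
Variables (R : realType) (n : nat).

(* The library norm `|x| of 'rV[R]_n is the sup norm. *)
Definition enorm (x : 'rV[R]_n) : R := Num.sqrt (\sum_i x ord0 i ^+ 2).

Definition eball : set 'rV[R]_n := [set x | enorm x <= 1].

Definition esphere : set 'rV[R]_n := [set x | enorm x = 1].

Lemma measurable_enorm : measurable_fun [set: 'rV[R]_n] enorm.
Proof.
apply: (@measurableT_comp _ _ _ _ _ _ (@Num.sqrt R)).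
  by apply: continuous_measurable_fun => x; exact: sqrt_continuous.
apply: measurable_sum => i; apply: measurable_funX.
exact: (@measurable_rV_coord R n i).
Qed.

Definition edir (x : 'rV[R]_n) : 'rV[R]_n := (enorm x)^-1 *: x.

Lemma measurable_edir : measurable_fun [set: 'rV[R]_n] edir.
Proof.
apply: measurable_fun_rVP => i.
rewrite [X in measurable_fun _ X](_ : _ =
    fun x : 'rV[R]_n => (enorm x) `^ (-1) * x ord0 i); last first.
  by apply/funext => x; rewrite /rV_coord /= mxE powR_inv1 ?sqrtr_ge0.
apply: measurable_funM; last exact: (@measurable_rV_coord R n i).
apply: (@measurableT_comp _ _ _ _ _ _ (@powR R ^~ (-1))).
  exact: measurable_powR.
exact: measurable_enorm.
Qed.

HB.instance Definition _ := @isMeasurableFun.Build _ _ _ _ edir measurable_edir.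

Definition punctured_eball : set 'rV[R]_n := [set x | 0 < enorm x <= 1].

Lemma measurable_punctured_eball : measurable punctured_eball.
Proof.
rewrite (_ : punctured_eball = enorm @^-1` `]0, 1]).
  by rewrite -[X in measurable X]setTI; exact: measurable_enorm.
by apply/seteqP; split => x; rewrite /= in_itv.
Qed.

(* The unnormalized (n-1)-dimensional surface measure of the unit sphere: the
   measure of A is n times the volume of the cone {t *: x | x in A, 0 < t <= 1};
   for n = 1 this is the counting measure on {-1, 1}.  It is carried by
   esphere. *)
Definition surface_measure (A : set 'rV[R]_n) : \bar R :=
  (n%:R%:E * lebesgue_rV R n (punctured_eball `&` edir @^-1` A))%E.

Let cone_measure :=
  mscale n%:R%:nng (mrestr (lebesgue_rV R n) measurable_punctured_eball).

Let surface_measureE : surface_measure = pushforward cone_measure edir.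
Proof. by apply/funext => A; rewrite /surface_measure setIC. Qed.

Let surface_measure0 : surface_measure set0 = 0%E.
Proof. by rewrite surface_measureE; exact: measure0. Qed.

Let surface_measure_ge0 A : (0 <= surface_measure A)%E.
Proof. by rewrite surface_measureE; exact: measure_ge0. Qed.

Let surface_measure_sigma_additive : semi_sigma_additive surface_measure.
Proof. by rewrite surface_measureE; exact: measure_semi_sigma_additive. Qed.

HB.instance Definition _ := isMeasure.Build _ _ _ surface_measure
  surface_measure0 surface_measure_ge0 surface_measure_sigma_additive.

End euclidean.

(* For K closed and bounded with 0 in its interior, the infimum is attained. *)
Definition minkowski (R : realType) n (K : set 'rV[R]_n) (x : 'rV[R]_n) : R :=
  inf [set a : R | 0 <= a /\ exists2 y, K y & x = a *: y].

Definition boundary (T : topologicalType) (A : set T) : set T :=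
  closure A `\` A°.

Definition star_body (R : realType) n (K : set 'rV[R]_n) : Prop :=
  [/\ closed K, bounded_set K,
      forall u : 'rV[R]_n, u != 0 ->
        exists p q : 'rV[R]_n, p != q /\
          [set x | boundary K x /\ x != 0 /\ exists t : R, x = t *: u]
          = [set p; q],
      K° 0 & continuous (minkowski K)].

Definition origin_symmetric (R : realType) n (K : set 'rV[R]_n) : Prop :=
  [set - x | x in K] = K.

Definition grassmannian (R : realType) (n m : nat) : Type :=
  {H : {vspace 'rV[R]_n} | \dim H == m}.
HB.instance Definition _ (R : realType) n m :=
  Choice.on (grassmannian R n m).

Section subspace.
Variables (R : realType) (n m : nat).
Implicit Types H : grassmannian R n m.

Definition subspace_set H : set 'rV[R]_n := [set x | x \in val H].

(* A matrix whose rows form an orthonormal basis of H, so that y |-> y *m frame H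
   is a linear isometry from R^m onto H; the volumes and integrals below do not
   depend on its choice. *)
Definition frame H : 'M[R]_(m, n) :=
  get [set B : 'M[R]_(m, n) | B *m B^T = 1%:M /\
    subspace_set H = range (fun y : 'rV[R]_m => y *m B)].

(* m-dimensional Lebesgue measure of the part of A lying in H. *)
Definition subspace_volume H (A : set 'rV[R]_n) : \bar R :=
  lebesgue_rV R m [set y | A (y *m frame H)].

(* The integral is over the unit sphere of H, parametrized by that of R^m;
   only the values of f on the sphere of R^n matter. *)
Definition radon (f : 'rV[R]_n -> R) H : R :=
  \int[@surface_measure R m]_(y in @esphere R m) f (y *m frame H).

Definition sphere_continuous (f : 'rV[R]_n -> R) : Prop :=
  {within @esphere R n, continuous f}.

Definition radon_range : set {uniform grassmannian R n m -> R} :=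
  [set radon f | f in sphere_continuous].

(* Functionals on radon_range are represented by maps on all functions; only
   their values on radon_range are constrained or used.  The topology of
   {uniform _ -> R} is that of the sup norm. *)
Definition positive_functional (nu : {uniform grassmannian R n m -> R} -> R)
    : Prop :=
  [/\ forall (a : R) (g h : grassmannian R n m -> R),
        radon_range g -> radon_range h ->
        nu (fun H => a * g H + h H) = a * nu g + nu h,
      {within radon_range, continuous nu} &
      forall g : grassmannian R n m -> R,
        radon_range g -> (forall H, 0 <= g H) -> 0 <= nu g].

End subspace.

Definition generalized_intersection_body (R : realType) n (k : nat)
    (K : set 'rV[R]_n) : Prop :=
  exists2 nu : {uniform grassmannian R n (n - k) -> R} -> R,
    positive_functional nu &
    forall f : 'rV[R]_n -> R, sphere_continuous f ->
      \int[@surface_measure R n]_(x in @esphere R n) (minkowski K x ^- k * f x)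
      = nu (radon f).

Definition stability_constant (R : realType) (n k : nat) : R :=
  fine (lebesgue_rV R n (@eball R n)) `^ ((n - k)%:R / n%:R)
  / fine (lebesgue_rV R (n - k) (@eball R (n - k))).

(* Main.v *)
Require Import Defs.
From HB Require Import structures.
From mathcomp Require Import all_boot all_order all_algebra.
From mathcomp Require Import all_classical all_reals all_analysis.
From mathcomp Require Import measurable_realfun ring lra.
Set Implicit Arguments.
Unset Strict Implicit.
Unset Printing Implicit Defensive.
Import Order.TTheory GRing.Theory Num.Theory.
Import numFieldNormedType.Exports.
Local Open Scope classical_set_scope.
Local Open Scope ring_scope.

(** Write r_M for the Minkowski functional of a star body M of R^n, sigma for
    the surface measure of the unit sphere S, B^n for the unit ball of R^n, and
    put m = n - k.

    In polar coordinates, n |M| is the integral over S of r_M^-n ([vol_gauge]).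
    Inside an m-dimensional subspace H, this says that the Radon transform of
    r_M^-m takes at H the value m times the volume of the section of M by H,
    and, for the unit ball, that the Radon transform of the constant 1 is
    m |B^m| ([radon_section_volumes]).  With c = eps / |B^m|, the hypothesis on the
    sections thus states that the function
        f = r_L^-m + c - r_K^-m
    has a nonnegative Radon transform.  The positive functional that represents
    r_K^-k is therefore nonnegative at the transform of f; that is,
        n |K| = int_S r_K^-n <= int_S r_K^-k r_L^-m + c int_S r_K^-k.
    Hoelder's inequality with exponents n/k and n/m bounds the two integrals on
    the right by n |K|^(k/n) |L|^(m/n) and n |K|^(k/n) |B^n|^(m/n)
    ([hoelder_gauge]; for the second one the other body is the unit ball).
    Dividing by n |K|^(k/n) gives the theorem.

    Two points need care.  First, the polar formula is proved from the
    homogeneity of Lebesgue measure alone ([lebesgue_rV_scale]): sigma is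
    defined by volumes of cones, so the formula is an identity of volumes for a
    step function on the sphere, and passes to the limit.  Second, the formula
    computes the volume of the set where r_M <= 1, and this set is M only
    because M is star-shaped, which follows from the condition that every line
    through the origin meets the boundary in two points ([star_bodyE]). *)

(** * Measurability in R^n *)

Section measurability.
Variable R : realType.

Lemma measurable_mulmxr n p (B : 'M[R]_(n, p)) :
  measurable_fun [set: 'rV[R]_n] (fun x : 'rV[R]_n => x *m B).
Proof.
apply: measurable_fun_rVP => j.
rewrite [X in measurable_fun _ X](_ : _ =
    fun x : 'rV[R]_n => \sum_i x ord0 i * B i j); last first.
  by apply/funext => x; rewrite /rV_coord /= mxE.
apply: measurable_sum => i; apply: measurable_funM => //.
exact: (@measurable_rV_coord R n i).
Qed.

Lemma measurable_scalerV n (t : R) :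
  measurable_fun [set: 'rV[R]_n] (fun x : 'rV[R]_n => t *: x).
Proof.
rewrite [X in measurable_fun _ X](_ : _ = fun x => x *m t%:M).
  exact: measurable_mulmxr.
by apply/funext => x; rewrite mul_mx_scalar.
Qed.

Lemma measurable_rV_ball n (a : 'rV[R]_n) (e : R) : 0 < e ->
  measurable (ball a e).
Proof.
move=> e0.
rewrite (_ : ball a e = \bigcap_(i in [set: 'I_n])
    (@rV_coord R n i @^-1` ball (a ord0 i : R) e)).
  apply: fin_bigcap_measurable; first exact: finite_finset.
  move=> i _; rewrite -[X in measurable X]setTI.
  apply: measurable_rV_coord => //.
  exact: measurable_ball.
apply/seteqP; split=> x.
  by move=> [_ xa] i _; exact: xa.
by move=> xa; split=> // i j; rewrite (ord1 i); exact: xa.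
Qed.

(** The sigma-algebra is generated by the coordinates, the topology by the
    sup-norm balls; an open set is a countable union of balls whose centres
    have coordinates in Z/(N+1) and whose radius is 1/(N+1). *)
Lemma open_measurable_rV n (U : set 'rV[R]_n) : open U -> measurable U.
Proof.
move=> oU.
pose c (i : nat * 'rV[int]_n) : 'rV[R]_n :=
  \row_j ((i.2 ord0 j)%:~R / i.1.+1%:R).
pose F i := if pselect (ball (c i) (i.1.+1%:R^-1 : R) `<=` U) is left _
            then ball (c i) (i.1.+1%:R^-1 : R) else set0.
rewrite (_ : U = \bigcup_i F i).
  apply: countable_bigcupT_measurable => [|i]; first exact: countableP.
  rewrite /F; case: pselect => // _.
  by apply: measurable_rV_ball; rewrite invr_gt0.
apply/seteqP; split=> x; last first.
  by move=> [i _]; rewrite /F; case: pselect => // s /s.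
move=> Ux; have /nbhs_ballP[e /= e0 xeU] := open_nbhs_nbhs (conj oU Ux).
have [N Ne] : exists N : nat, N.+1%:R^-1 < e / 2.
  have := @ltr_add_invr R 0 (e/2); rewrite divr_gt0// => /(_ isT)[N].
  by rewrite add0r; exists N.
pose i := (N, \row_j Num.floor (N.+1%:R * x ord0 j)).
have cx : ball (c i) (N.+1%:R^-1 : R) x.
  split=> [|i0 j]; first by rewrite invr_gt0.
  rewrite (ord1 i0) !mxE /ball /=.
  have N0 : 0 < N.+1%:R :> R by rewrite ltr0n.
  rewrite -[X in _ - X](mulKf (lt0r_neq0 N0)) mulrC -mulrBr normrM.
  rewrite ger0_norm ?invr_ge0 ?ler0n// -[X in _ < X]mulr1 ltr_pM2l ?invr_gt0//.
  rewrite distrC ger0_norm ?subr_ge0 ?floor_le// ltrBlDr addrC.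
  by have := floorD1_gt (N.+1%:R * x ord0 j); rewrite intrD1.
exists i => //; rewrite /F; case: pselect => //; case => y cy.
by apply: xeU; apply: (@ball_splitr _ _ (c i)); apply: le_ball (ltW Ne) _ _.
Qed.

Lemma continuous_measurable_rV n (f : 'rV[R]_n -> R) :
  continuous f -> measurable_fun [set: 'rV[R]_n] f.
Proof.
move=> /continuousP cf; apply: (measurability _ (RGenOpens.measurableE R)).
move=> _ [_ [a [b ->] <-]]; rewrite setTI.
by apply: open_measurable_rV; apply: cf; exact: interval_open.
Qed.
End measurability.

(** * Homogeneity of Lebesgue measure *)

Section scaling.
Variable R : realType.

Lemma lebesgue_measure_scale (t : R) (A : set (measurableTypeR R)) : 0 < t ->
  measurable A ->
  (lebesgue_measure ((fun x : R => (t * x)%R) @^-1` A) =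
   (t^-1)%:E * lebesgue_measure A)%E.
Proof.
move=> t0 mA.
have mt : @measurable_fun _ _ (measurableTypeR R) (measurableTypeR R) setT
    (fun x => t * x).
  exact: measurable_funM.
have T0 : 0 <= t by exact: ltW.
pose mu' := (mscale (NngNum T0) (pushforward (@lebesgue_measure R)
  (fun x : measurableTypeR R => t * x : measurableTypeR R))
  : {measure set (measurableTypeR R) -> \bar R}).
have mu'E Y : mu' mt Y =
    (t%:E * lebesgue_measure ((fun x : R => (t * x)%R) @^-1` Y))%E.
  by [].
(* t times the image of the measure agrees with it on intervals *)
have -> : (lebesgue_measure A = mu' mt A)%E.
  apply: lebesgue_measure_unique => // X [[a b]] _ <-.
  rewrite mu'E (_ : _ @^-1` _ = `]a / t, b / t]%classic); last first.
    apply/seteqP; split=> x /=; rewrite !in_itv /=.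
      by rewrite ltr_pdivrMr// ler_pdivlMr// mulrC.
    by rewrite ltr_pdivrMr// ler_pdivlMr// mulrC.
  rewrite /= !lebesgue_measure_itv /= !lte_fin ltr_pM2r ?invr_gt0//.
  case: ifPn => _; last by rewrite mule0.
  by rewrite -!EFinB -EFinM -mulrBl mulrC divfK ?gt_eqF.
by rewrite mu'E muleA -EFinM mulVf ?gt_eqF// mul1e.
Qed.

Lemma lebesgue_rVS n (A : set 'rV[R]_n.+1) : lebesgue_rV R n.+1 A =
  (@lebesgue_measure R \x lebesgue_rV R n)%E (@rV_cons R n @^-1` A).
Proof. by []. Qed.

(** Induction on the dimension: after multiplication by t^(n+1), the image of
    the product measure under scaling has the right values on rectangles, and
    these determine a product measure. *)
Lemma lebesgue_rV_scale n (t : R) (A : set 'rV[R]_n) : 0 < t -> measurable A ->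
  (lebesgue_rV R n (( *:%R t) @^-1` A) =
   (t ^- n)%:E * lebesgue_rV R n A)%E.
Proof.
move=> t0; elim: n A => [|n IH] A mA.
  rewrite expr0 invr1 mul1e /= !diracE; congr ((nat_of_bool _)%:R%:E).
  by apply/idP/idP; rewrite !inE /= scaler0.
have mt : @measurable_fun _ _ (measurableTypeR R) (measurableTypeR R) setT
    (fun x => t * x).
  exact: measurable_funM.
pose S (p : measurableTypeR R * 'rV[R]_n) : measurableTypeR R * 'rV[R]_n :=
  (t * p.1, t *: p.2).
have mS : measurable_fun setT S.
  apply/measurable_fun_pairP; split.
    by apply: (measurableT_comp mt); exact: measurable_fst.
  by apply: (measurableT_comp (measurable_scalerV _)); exact: measurable_snd.
have tn : t ^+ n.+1 != 0 by rewrite expf_neq0 ?gt_eqF.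
have T0 : 0 <= t ^+ n.+1 by apply/exprn_ge0/ltW.
pose mu' := (mscale (NngNum T0)
    (pushforward (@lebesgue_measure R \x lebesgue_rV R n)%E S)
  : {measure set (measurableTypeR R * 'rV[R]_n) -> \bar R}).
have mu'E Y : mu' mS Y =
  ((t ^+ n.+1)%:E * (@lebesgue_measure R \x lebesgue_rV R n) (S @^-1` Y))%E.
  by [].
have mB : measurable (@rV_cons R n @^-1` A).
  by rewrite -[X in measurable X]setTI; exact: measurable_rV_cons.
have key : ((@lebesgue_measure R \x lebesgue_rV R n) (@rV_cons R n @^-1` A) =
    (t ^+ n.+1)%:E *
    (@lebesgue_measure R \x lebesgue_rV R n) (S @^-1` (@rV_cons R n @^-1` A)))%E.
  rewrite -mu'E; apply: product_measure_unique mB => X Y mX mY; rewrite mu'E.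
  rewrite (_ : _ @^-1` _ =
    ((fun x : R => t * x) @^-1` X) `*` (( *:%R t) @^-1` Y))//.
  rewrite product_measure1E; last 2 first.
  - by rewrite -[X in measurable X]setTI; exact: mt.
  - by rewrite -[X in measurable X]setTI; exact: measurable_scalerV.
  rewrite [X in (_ * (X * _))%E](lebesgue_measure_scale t0 mX) (IH _ mY).
  rewrite muleACA !muleA -!EFinM -mulrA -invfM -exprS.
  by rewrite (mulfV tn) mul1e.
rewrite !lebesgue_rVS key muleA -EFinM (mulVf tn) mul1e.
have -> : S @^-1` (@rV_cons R n @^-1` A) =
    @rV_cons R n @^-1` (( *:%R t) @^-1` A).
  apply/seteqP; split=> -[x y]; rewrite /preimage /=;
    rewrite (_ : rV_cons (S (x, y)) = t *: rV_cons (x, y))//;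
    apply/rowP => i; rewrite !mxE; case: unliftP => [j _|_] //=; by rewrite mxE.
by [].
Qed.

Lemma measurable_rV_cube n (r : R) :
  measurable [set x : 'rV[R]_n | forall i, `|x ord0 i| <= r].
Proof.
rewrite (_ : [set _ | _] = \bigcap_(i in [set: 'I_n])
  (@rV_coord R n i @^-1` `[-r, r])).
  apply: fin_bigcap_measurable; first exact: finite_finset.
  by move=> i _; rewrite -[X in measurable X]setTI; apply: measurable_rV_coord.
apply/seteqP; split=> x /= H i.
  by move=> _; rewrite /rV_coord /= in_itv /= -ler_norml.
by have := H i Logic.I; rewrite /rV_coord /= in_itv /= -ler_norml.
Qed.

(** Cubes compare with Euclidean balls up to a constant factor, so that their
    volume shows that bounded sets have finite volume and that the unit ball
    has positive volume. *)
Lemma lebesgue_rV_cube n (r : R) : 0 <= r ->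
  lebesgue_rV R n [set x | forall i, `|x ord0 i| <= r] = ((r *+ 2) ^+ n)%:E.
Proof.
move=> r0; elim: n => [|n IH].
  by rewrite expr0 /= diracE mem_set// => -[].
rewrite lebesgue_rVS.
have -> : @rV_cons R n @^-1` [set x | forall i, `|x ord0 i| <= r] =
    `[-r, r]%classic `*` [set x : 'rV[R]_n | forall i, `|x ord0 i| <= r].
  apply/seteqP; split=> -[x y] /=.
    rewrite in_itv /= -ler_norml => H; split => [|i].
      by have := H ord0; rewrite mxE unlift_none.
    by have := H (lift ord0 i); rewrite mxE liftK.
  rewrite in_itv /= -ler_norml => -[Hx Hy] i; rewrite mxE.
  by case: unliftP.
rewrite product_measure1E//; last exact: measurable_rV_cube.
rewrite [X in (X * _)%E]lebesgue_measure_itv IH /= lte_fin exprS EFinM.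
congr (_ * _)%E; rewrite -EFinB opprK -mulr2n; case: ltP => // rN.
have -> : r = 0 by lra.
by rewrite mul0rn.
Qed.
End scaling.

(** * The Euclidean norm and the unit sphere *)

Section enorm_theory.
Variables (R : realType) (n : nat).
Implicit Types x : 'rV[R]_n.

Lemma enorm_ge0 x : 0 <= enorm x. Proof. exact: sqrtr_ge0. Qed.

Lemma sqr_enorm x : enorm x ^+ 2 = \sum_i x ord0 i ^+ 2.
Proof. by rewrite sqr_sqrtr// sumr_ge0// => i _; exact: sqr_ge0. Qed.

Lemma sqr_enorm_mx x : (enorm x ^+ 2)%:M = x *m x^T.
Proof.
apply/matrixP => i j; rewrite !ord1 sqr_enorm !mxE /=.
by rewrite mulr1n; apply: eq_bigr => k _; rewrite mxE expr2.
Qed.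

Lemma enormZ t x : enorm (t *: x) = `|t| * enorm x.
Proof.
rewrite /enorm -sqrtr_sqr -sqrtrM ?sqr_ge0//; congr Num.sqrt.
by rewrite mulr_sumr; apply: eq_bigr => i _; rewrite mxE exprMn.
Qed.

Lemma coord_le_enorm x i : `|x ord0 i| <= enorm x.
Proof.
rewrite -sqrtr_sqr ler_sqrt ?sumr_ge0// => [|j _]; last exact: sqr_ge0.
by rewrite (bigD1 i)//= lerDl sumr_ge0// => j _; exact: sqr_ge0.
Qed.

Lemma enorm_gt0 x : (0 < enorm x) = (x != 0).
Proof.
apply/idP/idP => [|x0].
  apply: contraTneq => ->.
  by rewrite -(scale0r (0 : 'rV[R]_n)) enormZ normr0 mul0r ltxx.
rewrite lt_neqAle enorm_ge0 andbT; apply: contraNneq x0 => ne.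
apply/eqP/rowP => i; rewrite mxE; apply/eqP.
by rewrite -normr_le0 ne coord_le_enorm.
Qed.

Lemma enorm_le_coord x r : (forall i, `|x ord0 i| <= r) -> 0 <= r ->
  enorm x <= n.+1%:R * r.
Proof.
move=> xr r0; rewrite -(@ler_pXn2r _ 2) ?nnegrE ?enorm_ge0 ?mulr_ge0//.
rewrite sqr_enorm exprMn.
apply: (@le_trans _ _ (\sum_(i < n) r ^+ 2)).
  apply: ler_sum => i _; rewrite -real_normK ?num_real//.
  by rewrite ler_pXn2r ?nnegrE.
rewrite sumr_const card_ord -[leLHS]mulr_natl.
apply: ler_wpM2r; first exact: sqr_ge0.
rewrite -natrX ler_nat expnS expn1; apply: (leq_trans (leqnSn n)).
by rewrite leq_pmulr.
Qed.

Lemma edirZ t x : 0 < t -> edir (t *: x) = edir x.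
Proof.
move=> t0; rewrite /edir enormZ gtr0_norm// scalerA invfM mulrAC mulVf ?mul1r//.
by rewrite gt_eqF.
Qed.

Lemma enorm_edir x : x != 0 -> enorm (edir x) = 1.
Proof.
move=> x0; rewrite enormZ ger0_norm ?invr_ge0 ?enorm_ge0// mulVf//.
by rewrite gt_eqF// enorm_gt0.
Qed.

Lemma measurable_esphere : measurable (@esphere R n).
Proof.
rewrite -[X in measurable X]setTI.
exact: (@measurable_enorm R n measurableT _ (measurable_set1 1)).
Qed.

Lemma surface_out_sphere : @surface_measure R n (~` @esphere R n) = 0%E.
Proof.
rewrite /surface_measure (_ : _ `&` _ = set0) ?measure0 ?mule0//.
apply/seteqP; split=> // x [/= /andP[x0 _]]; apply.
by rewrite /esphere /= enorm_edir// -enorm_gt0.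
Qed.

End enorm_theory.

(** * Polar coordinates *)

Section radial.
Variables (R : realType) (n : nat).
Local Notation vol := (lebesgue_rV R n).

Lemma bernoulli_ineq m (d : R) : 0 <= d <= 1 -> 1 - m%:R * d <= (1 - d) ^+ m.
Proof.
move=> /andP[d0 d1]; elim: m => [|m IH]; first by rewrite mul0r subr0.
rewrite exprS; apply: (@le_trans _ _ ((1 - d) * (1 - m%:R * d))).
  rewrite -natr1; have : 0 <= m%:R :> R by []. nra.
by rewrite ler_wpM2l// subr_ge0.
Qed.

(** The volume of t S is t^n times that of S, which tends to the volume of S
    as t increases to 1.  Through this lemma open and closed balls, or the sets
    where a gauge is < 1 and <= 1, have the same volume, without any discussion
    of the measure of their boundaries. *)
Lemma vol_le_dilates (S S' : set 'rV[R]_n) : measurable S -> measurable S' ->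
  (forall (t : R) x, 0 < t < 1 -> S x -> S' (t *: x)) -> (vol S <= vol S')%E.
Proof.
move=> mS mS' SS'.
have H (t : R) : 0 < t < 1 -> ((t ^+ n)%:E * vol S <= vol S')%E.
  move=> /andP[t0 t1].
  have tn : t ^+ n != 0 by rewrite expf_neq0 ?gt_eqF.
  have : (vol S <= vol (( *:%R t) @^-1` S'))%E.
    apply: le_measure; rewrite ?inE//.
      by rewrite -[X in measurable X]setTI; exact: measurable_scalerV.
    by move=> x Sx; apply: SS'; rewrite ?t0.
  rewrite lebesgue_rV_scale// => le_vol.
  have tn0 : (0 <= (t ^+ n)%:E)%E by rewrite lee_fin exprn_ge0 ?ltW.
  have := lee_wpmul2l tn0 le_vol.
  by rewrite muleA -EFinM (mulfV tn) mul1e.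
have [voo|] := eqVneq (vol S') +oo%E; first by rewrite voo leey.
have : (0 <= vol S')%E by exact: measure_ge0.
case: (vol S') H => [v' H v'0 _|//|//].
rewrite lee_fin in v'0.
have := H (1 / 2); have : (0 <= vol S)%E by exact: measure_ge0.
case: (vol S) H => [v H v0 _|_ _|//].
  rewrite lee_fin in v0.
  rewrite lee_fin; apply/ler_addgt0Pr => e e0.
  (* by Bernoulli, shrinking by 1 - d loses at most n d v <= e of the volume v *)
  pose d := Num.min (1 / 2) (e / (n%:R * v + 1)).
  have nv : 0 <= n%:R * v by rewrite mulr_ge0.
  have d0 : 0 < d by rewrite lt_min !divr_gt0// ltr_wpDl.
  have d1 : d <= 1 / 2 by rewrite ge_min lexx.
  have dn : (n%:R * v + 1) * d <= e.
    by rewrite mulrC -ler_pdivlMr ?ltr_wpDl// ge_min lexx orbT.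
  have /H : 0 < 1 - d < 1 by lra.
  rewrite -EFinM lee_fin; have : 0 <= d <= 1 by lra.
  move=> /(bernoulli_ineq n) b; have : (1 - n%:R * d) * v <= (1 - d) ^+ n * v.
    by rewrite ler_wpM2r.
  nra.
have h : 0 < (1 / 2 : R) < 1 by apply/andP; split; lra.
move=> /(_ h); rewrite gt0_muley ?lte_fin ?exprn_gt0//; lra.
Qed.

Lemma vol_eq_dilates (S S' : set 'rV[R]_n) : measurable S -> measurable S' ->
  S' `<=` S ->
  (forall (t : R) x, 0 < t < 1 -> S x -> S' (t *: x)) -> vol S = vol S'.
Proof.
move=> mS mS' sub H; apply/eqP; rewrite eq_le vol_le_dilates//=.
by apply: le_measure; rewrite ?inE.
Qed.

(** The points strictly between the origin and the star-shaped surface whose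
    radial function is the n-th root of u.  The n-th power makes the volume
    linear in u. *)
Definition radial_region (u : 'rV[R]_n -> R) : set 'rV[R]_n :=
  [set x | 0 < enorm x /\ enorm x ^+ n < u (edir x)].

Lemma measurable_radial_region u : measurable_fun setT u ->
  measurable (radial_region u).
Proof.
move=> mu; rewrite (_ : radial_region u =
    (fun x => 0 < enorm x) @^-1` [set true] `&`
    (fun x => enorm x ^+ n < u (edir x)) @^-1` [set true]); last first.
  by apply/seteqP; split.
have me := @measurable_enorm R n.
apply: measurableI; rewrite -[X in measurable X]setTI.
  exact: measurable_fun_ltr.
apply: measurable_fun_ltr => //; first exact: measurable_funX.
exact: (measurableT_comp mu (@measurable_edir R n)).
Qed.

Hypothesis n0 : (0 < n)%N.

(** The surface measure of A is n times the volume of the truncated cone over A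
    of height 1; the cone of height r has r^n times this volume, and r^n = c
    here. *)
Lemma vol_cone (c : R) (A : set 'rV[R]_n) : 0 <= c -> measurable A ->
  (n%:R%:E * vol (radial_region (fun _ => c) `&` @edir R n @^-1` A))%E =
  (c%:E * @surface_measure R n A)%E.
Proof.
move=> c0 mA.
have mC : measurable (@edir R n @^-1` A).
  by rewrite -[X in measurable X]setTI; exact: measurable_edir.
move: c0; rewrite le_eqVlt => /predU1P[<-|c0].
  rewrite mul0e (_ : _ `&` _ = set0) ?measure0 ?mule0//.
  apply/seteqP; split => // x [[x0]]; rewrite ltNge exprn_ge0//.
  exact: enorm_ge0.
pose r := c `^ n%:R^-1.
have r0 : 0 < r by exact: powR_gt0.
have rn : r ^+ n = c.
  by rewrite -powR_mulrn ?ltW// -powRrM mulVf ?powRr1 ?ltW// pnatr_eq0 -lt0n.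
rewrite /surface_measure muleCA; congr (_ * _)%E.
have m1 : measurable (radial_region (fun=> 1) `&` @edir R n @^-1` A).
  by apply: measurableI => //; exact: measurable_radial_region.
have mc : measurable (radial_region (fun=> c) `&` @edir R n @^-1` A).
  by apply: measurableI => //; exact: measurable_radial_region.
have -> : vol (@punctured_eball R n `&` @edir R n @^-1` A) =
    vol (radial_region (fun=> 1) `&` @edir R n @^-1` A).
  apply: vol_eq_dilates => //.
  - by apply: measurableI => //; exact: measurable_punctured_eball.
  - move=> x [[x0 x1] Ax]; split => //; rewrite /punctured_eball /= x0/=.
    by rewrite -(@ler_pXn2r _ n)// ?nnegrE ?enorm_ge0// expr1n ltW.
  - move=> t x /andP[t0 t1] [/andP[x0 x1] Ax].
    have te : enorm (t *: x) = t * enorm x by rewrite enormZ gtr0_norm.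
    split; last by rewrite /preimage /= edirZ.
    rewrite /radial_region /= te mulr_gt0//; split=> //.
    by rewrite exprn_ilt1 -?lt0n ?mulr_ge0 ?ltW//; nra.
have -> : radial_region (fun=> 1) `&` @edir R n @^-1` A =
    ( *:%R r) @^-1` (radial_region (fun=> c) `&` @edir R n @^-1` A).
  apply/seteqP; split => x; rewrite /radial_region /preimage /=.
    rewrite edirZ// enormZ gtr0_norm// exprMn rn pmulr_rgt0//.
    by rewrite gtr_pMr.
  rewrite edirZ// enormZ gtr0_norm// exprMn rn pmulr_rgt0//.
  by rewrite gtr_pMr.
by rewrite lebesgue_rV_scale// rn muleA -EFinM mulfV ?mul1e// gt_eqF.
Qed.

Import HBNNSimple.

(** The region of a step function is the disjoint union of truncated cones over
    its level sets. *)
Lemma polar_nnsfun (s : {nnsfun 'rV[R]_n >-> R}) :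
  (\int[@surface_measure R n]_x (s x)%:E = n%:R%:E * vol (radial_region s))%E.
Proof.
rewrite integral_nnsfun// patch_setT sintegralE.
transitivity (\sum_(c \in range s) (n%:R%:E *
   vol (radial_region (fun=> c) `&` @edir R n @^-1` (s @^-1` [set c]))))%E.
  by apply: eq_fsbigr => c /set_mem[x _ <-]; rewrite vol_cone.
rewrite -ge0_mule_fsumr; last by move=> c; exact: measure_ge0.
congr (_ * _)%E; rewrite -measure_fsbig//; first last.
- apply/trivIsetP => i j _ _ ij; apply/seteqP.
  split=> // x [[_ /= xi] [_ /= xj]].
  by rewrite -xi -xj eqxx in ij.
- move=> c _; apply: measurableI; first exact: measurable_radial_region.
  by rewrite -[X in measurable X]setTI; exact: measurable_edir.
congr (vol _); rewrite fsbig_setU//; apply/seteqP; split => x.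
  by move=> [c _ [[x0 xc] /= sc]]; split=> //; rewrite sc.
by move=> [x0 xs]; exists (s (edir x)).
Qed.

(** Both sides are continuous along nondecreasing sequences of step functions;
    for the right-hand side this is where the strict inequality in the
    definition of the region matters. *)
Lemma polar (u : 'rV[R]_n -> R) :
  measurable_fun setT u -> (forall x, 0 <= u x) ->
  (\int[@surface_measure R n]_x (u x)%:E = n%:R%:E * vol (radial_region u))%E.
Proof.
move=> mu u0.
have mEu : measurable_fun setT (EFin \o u) by exact/measurable_EFinP.
pose f := nnsfun_approx measurableT mEu.
have nd := nd_nnsfun_approx measurableT mEu.
have cv x : (f j x)%:E @[j --> \oo] --> (u x)%:E.
  apply: (@cvg_nnsfun_approx _ _ _ _ measurableT _ mEu) => // y _.
  by rewrite lee_fin.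
have cvr x : f j x @[j --> \oo] --> u x by exact: (fine_cvg (cv x)).
have c1 : (\int[@surface_measure R n]_x (f j x)%:E)%E @[j --> \oo] -->
    (\int[@surface_measure R n]_x (u x)%:E)%E.
  rewrite (eq_integral (fun x => limn (fun j => (f j x)%:E))); last first.
    by move=> x _; apply/esym/cvg_lim => //; exact: cv.
  apply: cvg_monotone_convergence => //.
  - by move=> j; exact/measurable_EFinP.
  - by move=> j x _; rewrite lee_fin.
  - by move=> x _ i j ij; rewrite lee_fin; exact/lefP/nd.
have c2 : (\int[@surface_measure R n]_x (f j x)%:E)%E @[j --> \oo] -->
    (n%:R%:E * vol (radial_region u))%E.
  under eq_fun do rewrite polar_nnsfun.
  apply: cvgeZl => //.
  have -> : radial_region u = \bigcup_j radial_region (f j).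
    apply/seteqP; split=> x; last first.
      move=> [j _ [x0 xj]]; split=> //; apply: lt_le_trans xj _.
      apply: (cvgr_to_ge (cvr _)); near=> i; apply/lefP/nd.
      by near: i; exact: nbhs_infty_ge.
    move=> [x0 xu]; have [N _ /(_ N (leqnn N)) uN] :=
      @cvgr_gt _ _ _ _ _ _ (cvr (edir x)) _ xu.
    by exists N.
  apply: nondecreasing_cvg_mu => //.
  - by move=> j; exact: measurable_radial_region.
  - by apply: bigcupT_measurable => j; exact: measurable_radial_region.
  - move=> i j ij; apply/subsetPset => x [x0 xi]; split=> //.
    by apply: lt_le_trans xi _; exact/lefP/nd.
exact: cvg_unique c1 c2.
Unshelve. all: by end_near. Qed.
End radial.

(** * Gauges *)

Section gauge.
Variables (R : realType) (n : nat).
Implicit Type rho : 'rV[R]_n -> R.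
Local Notation vol := (lebesgue_rV R n).

(** What the polar formula uses of the Minkowski functional of a star body.  The
    notion is stable under restriction to a subspace, and covers the Euclidean
    norm.  The lower bound in the last clause expresses that the unit body is
    bounded; it makes the negative powers of the gauge bounded on the sphere. *)
Definition gauge rho : Prop := [/\ measurable_fun setT rho,
  forall t x, 0 < t -> rho (t *: x) = t * rho x &
  exists2 M : R, 0 < M & forall x, enorm x <= M * rho x].

Lemma gauge_gt0 rho x : gauge rho -> x != 0 -> 0 < rho x.
Proof.
move=> [_ _ [M M0 HM]]; rewrite -enorm_gt0 => x0.
by have := lt_le_trans x0 (HM x); rewrite pmulr_rgt0.
Qed.

Lemma gauge0 rho : gauge rho -> rho 0 = 0.
Proof. by move=> [_ /(_ 2 0 ltac:(lra)) + _]; rewrite scaler0; lra. Qed.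

Lemma gauge_ge0 rho x : gauge rho -> 0 <= rho x.
Proof.
move=> g; have [->|x0] := eqVneq x 0; first by rewrite gauge0.
exact/ltW/gauge_gt0.
Qed.

Lemma measurable_gaugeV rho k : gauge rho ->
  measurable_fun setT (fun x => rho x ^- k).
Proof.
move=> g; have [mr _ _] := g.
rewrite (_ : (fun x => _) = fun x => (rho x) `^ (- k%:R)).
  apply: (@measurableT_comp _ _ _ _ _ _ (@powR R ^~ (- k%:R))); last exact: mr.
  exact: measurable_powR.
by apply/funext => x; rewrite powRN powR_mulrn// gauge_ge0.
Qed.

Lemma measurable_gauge_body rho : gauge rho -> measurable [set x | rho x <= 1].
Proof.
move=> [mr _ _]; rewrite (_ : [set _ | _] = rho @^-1` `]-oo, 1]); last first.
  by apply/seteqP; split => x /=; rewrite in_itv.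
by rewrite -[X in measurable X]setTI; exact: mr.
Qed.

(** By homogeneity, |x|^n cancels: the radial region of rho^-n is the punctured
    set where rho is < 1. *)
Lemma radial_region_gauge rho x : gauge rho -> 0 < enorm x ->
  (enorm x ^+ n < rho (edir x) ^- n) = (rho x ^+ n < 1).
Proof.
move=> g x0; have [_ rZ _] := g.
rewrite /edir rZ ?invr_gt0// exprMn exprVn invfM invrK.
rewrite -[X in X < _]mulr1 ltr_pM2l ?exprn_gt0//.
by rewrite invf_gt1// exprn_gt0// gauge_gt0// -enorm_gt0.
Qed.

Hypothesis n0 : (0 < n)%N.

Lemma vol_origin : vol [set 0] = 0%E.
Proof.
have := @lebesgue_rV_cube R n 0 (lexx _); rewrite mul0rn expr0n gtn_eqF// => b0.
rewrite -[RHS]b0.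
congr (vol _); apply/seteqP; split => x /=.
  by move=> -> i; rewrite mxE normr0.
by move=> H; apply/rowP => i; apply/eqP; rewrite mxE -normr_le0.
Qed.

Lemma vol_gauge rho : gauge rho ->
  (n%:R%:E * vol [set x | (rho x <= 1)%R] =
   \int[@surface_measure R n]_(x in @esphere R n) (rho x ^- n)%:E)%E.
Proof.
move=> g; have [mr rZ _] := g.
have mle := measurable_gauge_body g.
have m0 : measurable [set (0 : 'rV[R]_n)].
  rewrite (_ : [set _] = @enorm R n @^-1` [set 0]); last first.
    apply/seteqP; split => x /=.
      move=> ->; apply/eqP.
      by rewrite eq_le enorm_ge0 andbT leNgt enorm_gt0 eqxx.
    by move=> x0; apply: contra_eq x0; rewrite -enorm_gt0 => /gt_eqF/negbT.
  by rewrite -[X in measurable X]setTI; apply: measurable_enorm.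
have mu := measurable_gaugeV n g.
have u0 x : 0 <= rho x ^- n by rewrite invr_ge0 exprn_ge0// gauge_ge0.
transitivity (\int[@surface_measure R n]_x (rho x ^- n)%:E)%E; last first.
  rewrite [LHS](@ge0_negligible_integral _ _ _ _ setT (~` @esphere R n))//.
  - by rewrite setTD setCK.
  - by apply: measurableC; exact: measurable_esphere.
  - exact/measurable_EFinP.
  - by move=> x _; rewrite lee_fin.
  - exact: surface_out_sphere.
rewrite polar//; congr (_ * _)%E.
have v0 : vol ([set x | rho x <= 1] `&` [set 0]) = 0%E.
  apply/eqP; rewrite eq_le measure_ge0 andbT -[leRHS]vol_origin.
  apply: le_measure; rewrite ?inE//; exact: measurableI.
rewrite (measureDI _ mle m0) [X in (_ + X)%E]v0 adde0.
apply: vol_eq_dilates.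
- exact: measurableD.
- exact: measurable_radial_region.
- move=> x [x0]; rewrite radial_region_gauge// => x1; split => /=.
    by rewrite -(@ler_pXn2r _ n)// ?nnegrE ?gauge_ge0// expr1n ltW.
  by move=> xz; rewrite xz enorm_gt0 eqxx in x0.
- move=> t x /andP[t0 t1] [/= x1 /eqP x0].
  have xx : 0 < enorm (t *: x) by rewrite enorm_gt0 scaler_eq0 negb_or gt_eqF.
  split => //; rewrite radial_region_gauge// rZ//.
  have := gauge_ge0 x g => rx.
  rewrite exprn_ilt1 -?lt0n ?mulr_ge0 ?(ltW t0)//.
  by apply: le_lt_trans t1; rewrite ler_piMr// ltW.
Qed.
End gauge.

(** * Minkowski functionals of star bodies *)

Section star.
Variables (R : realType) (n : nat) (K : set 'rV[R]_n).
Hypothesis sK : star_body K.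
Local Notation gK := (Defs.minkowski K).

Lemma star_body_ball : exists2 e : R, 0 < e &
  forall x : 'rV[R]_n, enorm x < e -> K x.
Proof.
have [_ _ _ K0 _] := sK.
have /nbhs_ballP[e /= e0 eK] := K0.
exists e => // x xe; apply: eK; split=> // i j; rewrite (ord1 i) mxE.
rewrite /ball /= sub0r normrN; exact: le_lt_trans (coord_le_enorm _ _) xe.
Qed.

Lemma star_body_bounded : exists2 M : R, 0 < M &
  forall x : 'rV[R]_n, K x -> enorm x <= M.
Proof.
have [_ [M [_ HM]] _ _ _] := sK.
pose M' := `|M| + 1.
have M0 : 0 < M' by rewrite ltr_wpDl.
have MM : M < M' by rewrite (le_lt_trans (ler_norm M))// ltrDl.
exists (n.+1%:R * M') => [|x Kx]; first by rewrite mulr_gt0.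
apply: enorm_le_coord (ltW M0) => i; have /= := HM _ MM x Kx.
apply: le_trans.
have -> : `|x| = mx_norm x by [].
by rewrite mx_normrE; exact: (le_bigmax _ (fun ij => `|x ij.1 ij.2|) (ord0, i)).
Qed.

Lemma star_body0 : K 0.
Proof. by have [_ _ _ K0 _] := sK; exact: nbhs_singleton. Qed.

Local Notation G x := [set a : R | 0 <= a /\ exists2 y, K y & x = a *: y].

Lemma gauge_set_neq0 x : G x !=set0.
Proof.
have [e e0 eK] := star_body_ball.
pose a := (enorm x + 1) / e.
have a0 : 0 < a by rewrite divr_gt0// ltr_wpDl// enorm_ge0.
exists a; split; first exact: ltW.
exists (a^-1 *: x); last by rewrite scalerA mulfV ?scale1r ?gt_eqF.
apply: eK; rewrite enormZ gtr0_norm ?invr_gt0// mulrC ltr_pdivrMr//.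
by rewrite /a mulrC divfK ?gt_eqF// ltrDl.
Qed.

Lemma gauge_set_lb x : has_lbound (G x).
Proof. by exists 0 => a []. Qed.

Lemma minkowski_le1 x : K x -> gK x <= 1.
Proof.
move=> Kx; apply: ge_inf; first exact: gauge_set_lb.
by split=> //; exists x => //; rewrite scale1r.
Qed.

Lemma minkowskiZ t x : 0 < t -> gK (t *: x) = t * gK x.
Proof.
have H (s : R) y : 0 < s -> gK (s *: y) <= s * gK y.
  move=> s0; rewrite mulrC -ler_pdivrMr//; apply: lb_le_inf.
    exact: gauge_set_neq0.
  move=> a [a0 [z Kz yz]]; rewrite ler_pdivrMr//; apply: ge_inf.
    exact: gauge_set_lb.
  split; first by rewrite mulr_ge0// ltW.
  by exists z => //; rewrite yz scalerA mulrC.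
move=> t0; apply/eqP; rewrite eq_le H//=.
rewrite mulrC -ler_pdivlMr// mulrC.
have := H t^-1 (t *: x); rewrite scalerA mulVf ?gt_eqF// scale1r.
by apply; rewrite invr_gt0.
Qed.

Lemma enorm_le_minkowski : exists2 M : R, 0 < M &
  forall x, enorm x <= M * gK x.
Proof.
have [M M0 HM] := star_body_bounded; exists M => // x.
rewrite mulrC -ler_pdivrMr//; apply: lb_le_inf; first exact: gauge_set_neq0.
move=> a [a0 [y Ky ->]]; rewrite enormZ ger0_norm// ler_pdivrMr//.
by rewrite ler_wpM2l// HM.
Qed.

(** On a segment from a point of K to a point outside, there is a last point of
    K, because K is closed; it lies on the boundary. *)
Lemma exit_point u (t0 t1 : R) : t0 < t1 -> K (t0 *: u) -> ~ K (t1 *: u) ->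
  exists2 s, t0 <= s < t1 & boundary K (s *: u).
Proof.
have [cK _ _ _ _] := sK => t01 K0 K1.
have ct : continuous (fun t : R => t *: u) by exact: scalel_continuous.
pose T := [set t : R | K (t *: u)].
have cT : closed T by apply: preimage_closed => // x _; exact: ct.
pose S := T `&` [set t | t <= t1].
have S0 : S t0 by split=> //; exact: ltW.
have Sub : has_ubound S by exists t1 => t [].
pose s := sup S.
have s0 : t0 <= s by exact: ub_le_sup.
have s1 : s <= t1 by apply: ge_sup => [|t []//]; exists t0.
have Ss : T s.
  apply: cT => B /nbhs_ballP[d /= d0 dB].
  have hS : has_sup S by split=> //; exists t0.
  have [e Se de] := sup_adherent d0 hS.
  have es : e <= s by exact: ub_le_sup.
  exists e; split; first by case: Se.
  by apply: dB; rewrite /ball /= ger0_norm ?subr_ge0//; rewrite -/s in de; lra.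
have s1' : s < t1.
  by rewrite lt_neqAle s1 andbT; apply: contra_notN K1 => /eqP <-.
exists s; first by rewrite s0.
split; first exact: subset_closure.
move=> Ki; have : nbhs s T by apply: ct.
move=> /nbhs_ballP[d /= d0 dT].
pose e := Num.min (d / 2) (t1 - s).
have e0 : 0 < e by rewrite lt_min divr_gt0//= subr_gt0.
have e1 : e <= d / 2 by rewrite ge_min lexx.
have e2 : e <= t1 - s by rewrite ge_min lexx orbT.
have : S (s + e).
  split; last by rewrite /=; lra.
  by apply: dT; rewrite /ball /= opprD addrA subrr sub0r normrN gtr0_norm//; lra.
by move=> /(ub_le_sup Sub); rewrite -/s; lra.
Qed.

Lemma boundary_neq0 s (u : 'rV[R]_n) : boundary K (s *: u) -> s != 0.
Proof.
move=> [_]; apply: contra_notN => /eqP ->; rewrite scale0r.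
by have [] := sK.
Qed.

(** Star-shapedness.  Suppose that x is not in K while some y = x / a with a < 1
    is.  The line through x then crosses the boundary three times: between 0
    and x, between x and y, and on the opposite half-line, where K is bounded.
    Only two crossings are allowed. *)
Lemma minkowski_lt1 x : gK x < 1 -> K x.
Proof.
move=> /(inf_lt (gauge_set_neq0 x))[a [a0 [y Ky xy]] a1].
have [az|an0] := eqVneq a 0.
  by rewrite xy az scale0r; exact: star_body0.
have {an0}a0 : 0 < a by rewrite lt_neqAle eq_sym an0.
apply: contrapT => nKx.
have x0 : x != 0 by apply: contra_notN nKx => /eqP ->; exact: star_body0.
have [s1 /andP[s10 s11] b1] : exists2 s, 0 <= s < 1 & boundary K (s *: x).
  by apply: exit_point => //; rewrite ?scale0r ?scale1r//; exact: star_body0.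
(* from y inwards to x, so that parameters increase along - x *)
have [s2 /andP[s20 s21] b2] :
    exists2 s, - a^-1 <= s < -1 & boundary K (s *: (- x)).
  apply: exit_point.
  - by rewrite ltrN2 invf_gt1.
  - by rewrite scaleNr scalerN opprK xy scalerA mulVf ?scale1r ?gt_eqF.
  - by rewrite scaleN1r opprK.
have [M M0 HM] := star_body_bounded.
have ex0 : 0 < enorm x by rewrite enorm_gt0.
(* a point beyond the bound M on the norms of the points of K *)
have [s3 /andP[s30 s31] b3] :
    exists2 s, 0 <= s < (M + 1) / enorm x & boundary K (s *: (- x)).
  apply: exit_point.
  - by rewrite divr_gt0// addr_gt0.
  - by rewrite scale0r; exact: star_body0.
  - move=> /HM; rewrite scalerN -scaleNr enormZ normrN gtr0_norm.
      by rewrite divfK ?gt_eqF//; lra.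
    by rewrite divr_gt0// addr_gt0.
have s1n := boundary_neq0 b1; have s3n := boundary_neq0 b3.
have [_ _ /(_ x x0)[p [q [_ pq]]] _ _] := sK.
have inpq s : boundary K (s *: x) -> s != 0 -> s *: x = p \/ s *: x = q.
  move=> b sn; suff : [set p; q] (s *: x) by [].
  by rewrite -pq; split=> //; split; [rewrite scaler_eq0 negb_or sn|exists s].
rewrite scalerN -scaleNr in b2; rewrite scalerN -scaleNr in b3.
have sx s t : s *: x = t *: x -> s = t.
  move=> /eqP; rewrite -subr_eq0 -scalerBl scaler_eq0 (negbTE x0) orbF.
  by rewrite subr_eq0 => /eqP.
have d12 : s1 *: x <> - s2 *: x by move=> /sx s12; move: s12 s11 s21; clear; lra.
have d13 : s1 *: x <> - s3 *: x.
  by move=> /sx s13; move/eqP: s3n; move: s13 s10 s30; clear; lra.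
have d23 : - s2 *: x <> - s3 *: x.
  by move=> /sx s23; move: s23 s21 s30; clear; lra.
have s2n : - s2 != 0 by rewrite oppr_eq0; apply: contraTneq s21 => ->; lra.
have s3n' : - s3 != 0 by rewrite oppr_eq0.
case: (inpq _ b1 s1n) d12 d13 => -> ; case: (inpq _ b2 s2n) d23 => -> //;
  by case: (inpq _ b3 s3n') => -> .
Qed.

(** A point x where the functional equals 1 is the limit of the points t x with
    t < 1, which are in K by [minkowski_lt1]; and K is closed. *)
Lemma star_bodyE : K = [set x | gK x <= 1].
Proof.
apply/seteqP; split=> [x /minkowski_le1//|x /= x1].
have [cK _ _ _ _] := sK.
have ct : continuous (fun t : R => t *: x) by exact: scalel_continuous.
pose T := [set t : R | K (t *: x)].
have cT : closed T by apply: preimage_closed => // z _; exact: ct.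
suff : T 1 by rewrite /T /= scale1r.
apply: cT => B /nbhs_ballP[d /= d0 dB].
pose e := Num.min (d / 2) (1 / 2).
have e0 : 0 < e by rewrite lt_min !divr_gt0.
have e1 : e <= d / 2 by rewrite ge_min lexx.
have e2 : e <= 1 / 2 by rewrite ge_min lexx orbT.
exists (1 - e); split.
  apply: minkowski_lt1; rewrite minkowskiZ; last by lra.
  have : gK x * (1 - e) <= 1 * (1 - e) by rewrite ler_wpM2r//; lra.
  lra.
by apply: dB; rewrite /ball /= opprB addrC subrK gtr0_norm//; lra.
Qed.

Lemma minkowski_gauge : gauge gK.
Proof.
have [_ _ _ _ ck] := sK; split.
- exact: continuous_measurable_rV.
- exact: minkowskiZ.
- exact: enorm_le_minkowski.
Qed.
End star.

(** * Orthonormal frames of subspaces *)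

Section frames.
Variable R : realType.

(** Gram-Schmidt: the last m rows are orthonormalized by induction, and the
    first row a is replaced by the normalization of its component v orthogonal
    to them, which is nonzero since the rows are independent. *)
Lemma orthonormalize m n (A : 'M[R]_(m, n)) : row_free A ->
  exists2 B : 'M[R]_(m, n), B *m B^T = 1%:M & (B <= A)%MS.
Proof.
elim: m A => [|m IH] A freeA.
  by exists A; rewrite ?submx_refl//; apply/matrixP => -[].
move: A freeA; rewrite -[m.+1]add1n => A.
rewrite -[A]vsubmxK; move: (usubmx A) (dsubmx A) => a A' freeA.
have /IH[B BB BA1] : row_free A'.
  apply: inj_row_free => v vA.
  have : row_mx (0 : 'M[R]_1) v *m col_mx a A' = 0 *m col_mx a A'.
    by rewrite mul_row_col !mul0mx add0r vA.
  by move/(row_free_inj freeA); rewrite -row_mx0 => /eq_row_mx[].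
pose v := a - a *m B^T *m B.
have vB : v *m B^T = 0 by rewrite mulmxBl -(mulmxA (a *m B^T)) BB mulmx1 subrr.
have v0 : 0 < enorm v.
  rewrite enorm_gt0; apply/eqP => /eqP; rewrite subr_eq0 => /eqP aE.
  have /submxP[c ac] : (a <= A')%MS by rewrite aE (submx_trans (submxMl _ _)).
  have : row_mx (1%:M : 'M[R]_1) (- c) *m col_mx a A' = 0 *m col_mx a A'.
    by rewrite mul_row_col mul1mx mulNmx -ac subrr mul0mx.
  move/(row_free_inj freeA); rewrite -row_mx0 => /eq_row_mx[/matrixP/(_ 0 0)].
  by rewrite !mxE => /eqP; rewrite oner_eq0.
pose u := (enorm v)^-1 *: v.
have uu : u *m u^T = 1%:M.
  rewrite -sqr_enorm_mx enormZ ger0_norm ?invr_ge0 ?enorm_ge0//.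
  by rewrite mulVf ?expr1n ?gt_eqF.
have uB : u *m B^T = 0 by rewrite -scalemxAl vB scaler0.
exists (col_mx u B).
  rewrite tr_col_mx mul_col_row uu uB BB.
  rewrite -[B *m u^T]trmxK trmx_mul trmxK uB trmx0.
  by rewrite -scalar_mx_block.
have aA : (a <= col_mx a A')%MS by rewrite -addsmxE addsmxSl.
have A'A : (A' <= col_mx a A')%MS by rewrite -addsmxE addsmxSr.
have BA := submx_trans BA1 A'A.
rewrite col_mx_sub BA andbT scalemx_sub// addmx_sub// eqmx_opp.
exact: submx_trans (submxMl _ _) BA.
Qed.

Lemma subspace_orthonormal_basis m n (H : grassmannian R n m) :
  exists B : 'M[R]_(m, n), B *m B^T = 1%:M /\
    subspace_set H = range (fun y : 'rV[R]_m => y *m B).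
Proof.
case: H => U /= dimU; rewrite /subspace_set /=; move/eqP: dimU => dimU.
case: _ / dimU.
pose X := vbasis U; pose A : 'M[R]_(\dim U, n) := \matrix_i X`_i.
have mulA (c : 'rV[R]_(\dim U)) : c *m A = \sum_i c ord0 i *: X`_i.
  by rewrite mulmx_sum_row; apply: eq_bigr => i _; rewrite rowK.
have freeA : row_free A.
  have /freeP fX := basis_free (vbasisP U).
  apply: inj_row_free => v; rewrite mulA => /fX v0.
  by apply/rowP => i; rewrite v0 mxE.
have [B BB BA] := orthonormalize freeA; exists B; split=> //.
have AB : (A <= B)%MS.
  have rB : row_free B by apply/row_freeP; exists B^T.
  by rewrite -(geq_leqif (mxrank_leqif_sup BA)) (eqP freeA) (eqP rB).
apply/seteqP; split=> x /=.
  move=> xU; have /submxP[y ->] : (x <= B)%MS; last by exists y.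
  apply: submx_trans AB.
  rewrite (coord_vbasis xU) (_ : \sum_i _ = (\row_i coord X i x) *m A).
    exact: submxMl.
  by rewrite mulA; apply: eq_bigr => i _; rewrite mxE.
move=> [y _ <-]; have /submxP[c ->] : (y *m B <= A)%MS.
  exact: submx_trans (submxMl _ _) BA.
rewrite mulA; apply: memv_suml => i _; apply: memvZ; apply: vbasis_mem.
by apply: mem_nth; rewrite size_tuple.
Qed.

Lemma enorm_mul_orthonormal m n (B : 'M[R]_(m, n)) (y : 'rV[R]_m) :
  B *m B^T = 1%:M -> enorm (y *m B) = enorm y.
Proof.
move=> BB; have : (enorm (y *m B) ^+ 2)%:M = (enorm y ^+ 2)%:M :> 'M[R]_1.
  by rewrite !sqr_enorm_mx trmx_mul mulmxA -(mulmxA y) BB mulmx1.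
move=> /matrixP/(_ 0 0); rewrite !mxE /= !mulr1n => /eqP.
by rewrite eqrXn2 ?enorm_ge0// => /eqP.
Qed.

Lemma enorm_frame m n (H : grassmannian R n m) y :
  enorm (y *m frame H) = enorm y.
Proof.
apply: enorm_mul_orthonormal.
by have [] := getPex (subspace_orthonormal_basis H).
Qed.

Lemma mul_frame_in m n (H : grassmannian R n m) y :
  subspace_set H (y *m frame H).
Proof.
have [_ ->] := getPex (subspace_orthonormal_basis H).
by exists y.
Qed.

Lemma gauge_frame m n (H : grassmannian R n m) (rho : 'rV[R]_n -> R) :
  gauge rho -> gauge (fun y => rho (y *m frame H)).
Proof.
move=> [mr rZ [M M0 HM]]; split.
- exact: (measurableT_comp mr (measurable_mulmxr _)).
- by move=> t y t0; rewrite -scalemxAl rZ.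
- by exists M => // y; rewrite -(enorm_frame H).
Qed.
End frames.

(** * Hoelder's inequality for integer powers *)

Section hoelder_pow.
Local Open Scope ereal_scope.
Context d (T : measurableType d) (R : realType).
Variable mu : {measure set T -> \bar R}.

Lemma hoelder_pow (D : set T) (f g : T -> R) (k m : nat) :
  measurable D -> (0 < k)%N -> (0 < m)%N ->
  measurable_fun setT f -> measurable_fun setT g ->
  (forall x, 0 <= f x)%R -> (forall x, 0 <= g x)%R ->
  \int[mu]_(x in D) (f x ^+ k * g x ^+ m)%:E <=
  (\int[mu]_(x in D) (f x ^+ (k + m))%:E) `^ (k%:R / (k + m)%:R) *
  (\int[mu]_(x in D) (g x ^+ (k + m))%:E) `^ (m%:R / (k + m)%:R).
Proof.
move=> mD k0 m0 mf mg f0 g0.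
have kR : (0 < k%:R :> R)%R by rewrite ltr0n.
have mR : (0 < m%:R :> R)%R by rewrite ltr0n.
pose F := (fun x => f x ^+ k)%R \_ D; pose G := (fun x => g x ^+ m)%R \_ D.
have mF : measurable_fun setT F.
  by apply/(measurable_restrictT _ mD)/measurable_funTS/measurable_funX.
have mG : measurable_fun setT G.
  by apply/(measurable_restrictT _ mD)/measurable_funTS/measurable_funX.
have := @hoelder _ _ _ mu F G ((k + m)%:R / k%:R)%R ((k + m)%:R / m%:R)%R mF mG.
rewrite !divr_gt0 ?ltr0n ?addn_gt0 ?k0// => /(_ isT isT).
have -> : ((((k + m)%:R / k%:R)^-1 + ((k + m)%:R / m%:R)^-1) = 1 :> R)%R.
  by rewrite !invf_div -mulrDl -natrD mulfV// pnatr_eq0 -lt0n addn_gt0 k0.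
move=> /(_ erefl); rewrite Lnorm1 unlock !invf_div.
congr (_ <= _ `^ _ * _ `^ _).
- rewrite [RHS]integral_mkcond; apply: eq_integral => x _.
  rewrite /F /G /patch /=; case: ifP => _; last by rewrite mul0r normr0.
  by rewrite ger0_norm// mulr_ge0// exprn_ge0.
- rewrite [RHS]integral_mkcond; apply: eq_integral => x _.
  rewrite /F /patch /=; case: ifP => _; last first.
    by rewrite normr0 powR0// gt_eqF// divr_gt0// ltr0n addn_gt0 k0.
  rewrite ger0_norm ?exprn_ge0// -!powR_mulrn// -powRrM mulrCA mulfV ?mulr1//.
  by rewrite gt_eqF.
- rewrite [RHS]integral_mkcond; apply: eq_integral => x _.
  rewrite /G /patch /=; case: ifP => _; last first.
    by rewrite normr0 powR0// gt_eqF// divr_gt0// ltr0n addn_gt0 k0.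
  rewrite ger0_norm ?exprn_ge0// -!powR_mulrn// -powRrM mulrCA mulfV ?mulr1//.
  by rewrite gt_eqF.
Qed.
End hoelder_pow.

(** * Integrals of powers of gauges over the sphere *)

Section sphere_integrals.
Variables (R : realType) (n : nat).
Local Notation vol := (lebesgue_rV R n).
Local Notation S := (@esphere R n).
Local Notation sigma := (@surface_measure R n).
Implicit Types rho : 'rV[R]_n -> R.

Lemma vol_gauge_fin rho : gauge rho -> vol [set x | rho x <= 1] \is a fin_num.
Proof.
move=> g; have [_ _ [M M0 HM]] := g.
rewrite ge0_fin_numE//.
apply: (@le_lt_trans _ _ ((M *+ 2) ^+ n)%:E); last exact: ltry.
rewrite -(lebesgue_rV_cube _ (ltW M0)); apply: le_measure; rewrite ?inE.
- exact: measurable_gauge_body.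
- exact: measurable_rV_cube.
- move=> x /= x1 i; apply: le_trans (coord_le_enorm _ _) _.
  by apply: le_trans (HM x) _; rewrite ler_piMr// ltW.
Qed.

Lemma gauge_enorm : gauge (@enorm R n).
Proof.
split; first exact: measurable_enorm.
  by move=> t x t0; rewrite enormZ gtr0_norm.
by exists 1 => // x; rewrite mul1r.
Qed.

Lemma vol_eball_gt0 : 0 < fine (vol (@eball R n)).
Proof.
apply: fine_gt0; rewrite -[X in _ && X]ge0_fin_numE//.
rewrite (vol_gauge_fin gauge_enorm) andbT.
pose r : R := n.+1%:R^-1; have r0 : 0 < r by rewrite invr_gt0.
apply: (@lt_le_trans _ _ ((r *+ 2) ^+ n)%:E).
  by rewrite lte_fin exprn_gt0// pmulrn_lgt0.
rewrite -(lebesgue_rV_cube _ (ltW r0)); apply: le_measure; rewrite ?inE.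
- exact: measurable_rV_cube.
- exact: (measurable_gauge_body gauge_enorm).
- move=> x /= xr; rewrite /eball /=.
  by have := enorm_le_coord xr (ltW r0); rewrite /r mulfV.
Qed.

Lemma surface_sphere_fin : (sigma S < +oo)%E.
Proof.
rewrite /surface_measure.
apply: (@le_lt_trans _ _ (n%:R%:E * vol (@eball R n))%E).
  apply: lee_wpmul2l; first by rewrite lee_fin.
  apply: le_measure; rewrite ?inE.
  - apply: measurableI; first exact: measurable_punctured_eball.
    rewrite -[X in measurable X]setTI; apply: measurable_edir => //.
    exact: measurable_esphere.
  - exact: (measurable_gauge_body gauge_enorm).
  - by move=> x [/andP[_ x1] _].
by rewrite -(fineK (vol_gauge_fin gauge_enorm)) -EFinM ltry.
Qed.

(** Since the sphere has finite measure, tame functions are integrable over it;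
    unlike integrability, tameness is stable under products. *)
Definition tame (f : 'rV[R]_n -> R) : Prop := measurable_fun setT f /\
  exists C : R, forall x, enorm x = 1 -> `|f x| <= C.

Lemma tame_integrable f : tame f -> sigma.-integrable S (EFin \o f).
Proof.
move=> [mf [C HC]]; apply: measurable_bounded_integrable.
- exact: measurable_esphere.
- exact: surface_sphere_fin.
- exact: measurable_funTS.
- exists C; split; first exact: num_real.
  by move=> M CM x /= xS; apply: le_trans (HC x xS) (ltW CM).
Qed.

Lemma tameM f g : tame f -> tame g -> tame (fun x => f x * g x).
Proof.
move=> [mf [C HC]] [mg [C' HC']]; split; first exact: measurable_funM.
by exists (C * C') => x x1; rewrite normrM ler_pM// ?HC ?HC'.
Qed.

Lemma tameD f g : tame f -> tame g -> tame (fun x => f x + g x).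
Proof.
move=> [mf [C HC]] [mg [C' HC']]; split; first exact: measurable_funD.
by exists (C + C') => x x1; rewrite (le_trans (ler_normD _ _))// lerD ?HC ?HC'.
Qed.

Lemma tame_cst c : tame (fun=> c).
Proof. by split=> //; exists `|c|. Qed.

Lemma tame_gaugeV rho k : gauge rho -> tame (fun x => rho x ^- k).
Proof.
move=> g; split; first exact: measurable_gaugeV.
have [_ _ [M M0 HM]] := g; exists (M ^+ k) => x x1.
have r0 : 0 < rho x by rewrite gauge_gt0// -enorm_gt0 x1.
rewrite ger0_norm ?invr_ge0 ?exprn_ge0 ?(ltW r0)// -exprVn.
apply: lerXn2r; rewrite ?nnegrE ?invr_ge0 ?(ltW r0) ?(ltW M0)//.
by rewrite -[leLHS]mul1r ler_pdivrMr// -x1.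
Qed.

Hypothesis n0 : (0 < n)%N.

Lemma Rintegral_gauge rho : gauge rho ->
  \int[sigma]_(x in S) (rho x ^- n) = n%:R * fine (vol [set x | rho x <= 1]).
Proof.
move=> g; rewrite /Rintegral -vol_gauge//.
by rewrite -(fineK (vol_gauge_fin g)).
Qed.

(** The polar formula for the Euclidean norm, which is 1 on the sphere. *)
Lemma Rintegral_sphere_cst (c : R) :
  \int[sigma]_(x in S) c = c * (n%:R * fine (vol (@eball R n))).
Proof.
rewrite -(Rintegral_gauge gauge_enorm) -RintegralZl//.
- by apply: eq_Rintegral => x /set_mem ->; rewrite expr1n invr1 mulr1.
- exact: measurable_esphere.
- exact: tame_integrable (tame_gaugeV n gauge_enorm).
Qed.

(** Hoelder with exponents n/k and n/m, after which both integrals are volumes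
    by the polar formula. *)
Lemma hoelder_gauge (rho rho' : 'rV[R]_n -> R) k m : (0 < k)%N -> (0 < m)%N ->
  n = (k + m)%N -> gauge rho -> gauge rho' ->
  \int[sigma]_(x in S) (rho x ^- k * rho' x ^- m) <=
  n%:R * (fine (vol [set x | rho x <= 1]) `^ (k%:R / n%:R) *
          fine (vol [set x | rho' x <= 1]) `^ (m%:R / n%:R)).
Proof.
move=> k0 m0 nkm g g'.
have V0 (r : 'rV[R]_n -> R) : gauge r -> forall x, 0 <= (r x)^-1.
  by move=> gr x; rewrite invr_ge0 gauge_ge0.
have mV (r : 'rV[R]_n -> R) :
    gauge r -> measurable_fun setT (fun x => (r x)^-1).
  by move=> /(measurable_gaugeV 1).
have := @hoelder_pow _ _ _ sigma S _ _ k m (@measurable_esphere R n) k0 m0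
  (mV _ g) (mV _ g') (V0 _ g) (V0 _ g').
rewrite -nkm.
have E (r : 'rV[R]_n -> R) : gauge r ->
    (\int[sigma]_(x in S) ((r x)^-1 ^+ n)%:E)%E =
    (n%:R * fine (vol [set x | r x <= 1]))%:E.
  move=> gr; rewrite EFinM fineK ?vol_gauge_fin// vol_gauge//.
  by apply: eq_integral => x _; rewrite exprVn.
rewrite !E//.
have -> : (\int[sigma]_(x in S) ((rho x)^-1 ^+ k * (rho' x)^-1 ^+ m)%:E)%E =
    (\int[sigma]_(x in S) (rho x ^- k * rho' x ^- m))%:E.
  rewrite /Rintegral fineK.
    by apply: eq_integral => x _; rewrite !exprVn.
  apply: integrable_fin_num; first exact: measurable_esphere.
  exact: tame_integrable (tameM (tame_gaugeV k g) (tame_gaugeV m g')).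
rewrite !poweR_EFin -EFinM lee_fin => /le_trans; apply.
have nR0 : n%:R != 0 :> R by rewrite pnatr_eq0 -lt0n.
rewrite !powRM ?fine_ge0// mulrACA -powRD ?nR0 ?implybT//.
by rewrite -mulrDl -natrD -nkm mulfV// powRr1.
Qed.
End sphere_integrals.

(** * Sections of star bodies and the Radon transform *)

Section sections.
Variables (R : realType) (n m : nat).

Lemma subspace_volumeE (K : set 'rV[R]_n) (H : grassmannian R n m) :
  star_body K -> subspace_volume H (K `&` subspace_set H) =
  lebesgue_rV R m [set y | Defs.minkowski K (y *m frame H) <= 1].
Proof.
move=> sK; rewrite /subspace_volume; congr (lebesgue_rV R m _).
rewrite {1}(star_bodyE sK); apply/seteqP; split=> y //=; first by case.
by move=> ?; split=> //; exact: mul_frame_in.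
Qed.

Lemma continuous_minkowskiV (K : set 'rV[R]_n) k x : star_body K -> x != 0 ->
  {for x, continuous (fun z => Defs.minkowski K z ^- k)}.
Proof.
move=> sK x0; have [_ _ _ _ ck] := sK.
have g0 := gauge_gt0 (minkowski_gauge sK) x0.
apply: continuousV; first by apply: expf_neq0; rewrite gt_eqF.
apply: (@continuous_comp _ _ _ (Defs.minkowski K) (fun t => t ^+ k)).
  exact: ck.
exact: exprn_continuous.
Qed.
End sections.

Section radon_transform.
Variables (R : realType) (n m : nat).
Hypothesis m0 : (0 < m)%N.
Implicit Types (H : grassmannian R n m) (K L : set 'rV[R]_n).

Lemma tame_gauge_frame H K : star_body K ->
  tame (fun y => Defs.minkowski K (y *m frame H) ^- m).
Proof.
move=> sK.
apply: (@tame_gaugeV _ _ (fun y => Defs.minkowski K (y *m frame H))).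
by apply: gauge_frame; exact: minkowski_gauge.
Qed.

(** The restriction of a Minkowski functional to a subspace, read in a frame, is
    a gauge, so that the Radon transform is an integral to which the polar
    formula in dimension m applies. *)
Lemma radon_section_volumes H K L (c : R) : star_body K -> star_body L ->
  radon (fun x => Defs.minkowski L x ^- m + c - Defs.minkowski K x ^- m) H =
  m%:R * (fine (subspace_volume H (L `&` subspace_set H)) +
     c * fine (lebesgue_rV R m (@eball R m)) -
     fine (subspace_volume H (K `&` subspace_set H))).
Proof.
move=> sK sL; rewrite /radon.
have mS := @measurable_esphere R m.
have tK := tame_gauge_frame H sK; have tL := tame_gauge_frame H sL.
have tc := @tame_cst R m c.
rewrite RintegralB//; try by apply: tame_integrable => //; exact: tameD.
rewrite RintegralD//; try exact: tame_integrable.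
rewrite Rintegral_sphere_cst//.
rewrite !(@Rintegral_gauge _ _ _ (fun y => Defs.minkowski _ (y *m frame H)))//;
  do ?by apply: gauge_frame; exact: minkowski_gauge.
rewrite !subspace_volumeE//; ring.
Qed.
End radon_transform.

(** * Stability *)

Theorem theorem1 (R : realType) (n k : nat) (K L : set 'rV[R]_n) (eps : R) :
  (1 <= k < n)%N ->
  star_body K -> origin_symmetric K ->
  star_body L -> origin_symmetric L ->
  generalized_intersection_body k K ->
  0 < eps ->
  (forall H : grassmannian R n (n - k),
    (subspace_volume H (K `&` subspace_set H)
      <= subspace_volume H (L `&` subspace_set H) + eps%:E)%E) ->
  (lebesgue_rV R n K `^ ((n - k)%:R / n%:R)
    <= lebesgue_rV R n L `^ ((n - k)%:R / n%:R)
       + (stability_constant R n k * eps)%:E)%E.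
Proof.
move=> /andP[k0 kn] sK _ sL _ [nu [_ _ nu_ge0] nuE] eps0 vol_le.
rewrite /stability_constant.
have m0 : (0 < n - k)%N by rewrite subn_gt0.
have nkm : n = (k + (n - k))%N by rewrite subnKC// ltnW.
have n0 : (0 < n)%N by exact: leq_trans kn.
move: (n - k)%N m0 nkm nu nu_ge0 nuE vol_le => m m0 nkm nu nu_ge0 nuE vol_le.
have gK := minkowski_gauge sK; have gL := minkowski_gauge sL.
set rK := Defs.minkowski K in gK; set rL := Defs.minkowski L in gL.
pose bm := fine (lebesgue_rV R m (@eball R m)).
have bm0 : 0 < bm := vol_eball_gt0 R m.
(* chosen so that the Radon transform of the constant c is m eps *)
pose c := eps / bm.
pose f x := rL x ^- m + c - rK x ^- m.
have cf : sphere_continuous f.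
  apply: continuous_in_subspaceT => x /set_mem x1.
  have x0 : x != 0 by rewrite -enorm_gt0 x1.
  apply: (@continuousB _ _ _ (fun z => rL z ^- m + c) (fun z => rK z ^- m));
    last exact: continuous_minkowskiV.
  apply: (@continuousD _ _ _ (fun z => rL z ^- m) (cst c)).
    exact: continuous_minkowskiV.
  exact: cst_continuous.
have finsub M (H : grassmannian R n m) : star_body M ->
    subspace_volume H (M `&` subspace_set H) \is a fin_num.
  move=> sM; rewrite subspace_volumeE//.
  by apply: vol_gauge_fin; apply: gauge_frame; exact: minkowski_gauge.
have f0 (H : grassmannian R n m) : 0 <= radon f H.
  rewrite [radon f H](radon_section_volumes m0 H c sK sL) mulr_ge0//.
  rewrite /c -/bm divfK ?gt_eqF//.
  by rewrite subr_ge0 -lee_fin EFinD !fineK ?finsub//; exact: vol_le.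
have mS := @measurable_esphere R n.
have iK j : tame (fun x => rK x ^- j) by exact: tame_gaugeV.
have iL j : tame (fun x => rL x ^- j) by exact: tame_gaugeV.
pose I (g : 'rV[R]_n -> R) := \int[@surface_measure R n]_(x in @esphere R n) g x.
have key : I (fun x => rK x ^- n) <=
    I (fun x => rK x ^- k * rL x ^- m) + c * I (fun x => rK x ^- k).
  have := nu_ge0 _ (ex_intro2 _ _ f cf erefl) f0.
  rewrite -nuE// -/rK.
  have -> : \int[@surface_measure R n]_(x in @esphere R n) (rK x ^- k * f x) =
      I (fun x => rK x ^- k * rL x ^- m + c * rK x ^- k - rK x ^- n).
    apply: eq_Rintegral => x _; rewrite /f nkm exprD invfM.
    ring.
  have tKL := tameM (iK k) (iL m); have tcK := tameM (tame_cst n c) (iK k).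
  rewrite /I RintegralB//; try by apply: tame_integrable => //; exact: tameD.
  rewrite RintegralD//; try exact: tame_integrable.
  by rewrite RintegralZl// ?subr_ge0//; exact: tame_integrable.
pose vK := fine (lebesgue_rV R n K); pose vL := fine (lebesgue_rV R n L).
pose vB := fine (lebesgue_rV R n (@eball R n)).
have EK : lebesgue_rV R n K = vK%:E.
  by rewrite /vK fineK// {1}(star_bodyE sK); exact: vol_gauge_fin.
have EL : lebesgue_rV R n L = vL%:E.
  by rewrite /vL fineK// {1}(star_bodyE sL); exact: vol_gauge_fin.
have vK0 : 0 <= vK by exact: fine_ge0.
have HL : I (fun x => rK x ^- k * rL x ^- m) <=
    n%:R * (vK `^ (k%:R / n%:R) * vL `^ (m%:R / n%:R)).
  have := hoelder_gauge n0 k0 m0 nkm gK gL.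
  by rewrite -!star_bodyE.
(* the second body is the unit ball, whose gauge is 1 on the sphere *)
have HB : I (fun x => rK x ^- k) <=
    n%:R * (vK `^ (k%:R / n%:R) * vB `^ (m%:R / n%:R)).
  have := hoelder_gauge n0 k0 m0 nkm gK (gauge_enorm R n).
  rewrite -star_bodyE//; congr (_ <= _).
  by apply: eq_Rintegral => x /set_mem ->; rewrite expr1n invr1 mulr1.
have IK : I (fun x => rK x ^- n) = n%:R * vK.
  by rewrite /I Rintegral_gauge// -star_bodyE.
rewrite EK EL !poweR_EFin -EFinD lee_fin -/bm -/vB.
have -> : vB `^ (m%:R / n%:R) / bm * eps = c * vB `^ (m%:R / n%:R).
  by rewrite /c; ring.
have nR : 0 < n%:R :> R by rewrite ltr0n.
have c0 : 0 <= c by rewrite divr_ge0// ltW.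
(* the inequality below can be divided by vK^(k/n) only if vK > 0 *)
move: vK0; rewrite le_eqVlt => /predU1P[<-|vKp].
  rewrite powR0; last by rewrite gt_eqF// divr_gt0// ltr0n.
  by apply: addr_ge0; [|apply: mulr_ge0 => //]; exact: powR_ge0.
have main : vK <= vK `^ (k%:R / n%:R) *
    (vL `^ (m%:R / n%:R) + c * vB `^ (m%:R / n%:R)).
  rewrite -(ler_pM2l nR) -IK; apply: le_trans key _.
  rewrite mulrDr mulrDr; apply: lerD => //.
  by rewrite (mulrCA _ c) (mulrCA _ c); exact: ler_wpM2l.
have split : vK = vK `^ (k%:R / n%:R) * vK `^ (m%:R / n%:R).
  rewrite -powRD ?(gt_eqF vKp) ?implybT// -mulrDl -natrD -nkm mulfV ?gt_eqF//.
  by rewrite powRr1// ltW.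
move: main; rewrite {1}split ler_pM2l//; exact: powR_gt0.
Qed.
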